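(* Fix integers $m\ge1$, $t$ with $0\le t<m$, $\lambda\ge1$, and a prime power $q$. There exists a constant $m'_0=m'_0(m,t,q,\lambda)$ such that, for every $m'\geq m'_0$ (with $m'\ge m$) and every $t$-design $D$ of index $\lambda$ in the bilinear forms scheme $\operatorname{Bil}_q(m,m')$, $$\operatorname{span}_{\mathbb{C}}\{g\boldsymbol{1}_D\mid g\in G\}=U_0\oplus U_{t+1}\oplus U_{t+2}\oplus\cdots\oplus U_m,$$ where $G=\mathbb{F}_q^{m'\times m}\rtimes(\operatorname{GL}(m,q)\times\operatorname{GL}(m',q))$ and $U_j=\operatorname{span}_{\mathbb{C}}\{\chi_C\mid C\in X,\ \operatorname{rank}(C)=j\}$ for $0\le j\le m$. In particular, $$\dim_{\mathbb{Q}}\operatorname{span}_{\mathbb{Q}}\{g\boldsymbol{1}_D\mid g\in G\}=q^{mm'}-\sum_{j=1}^{t}{m\brack j}_q(q^{m'}-1)(q^{m'-1}-1)\cdots(q^{m'-j+1}-1)\,q^{\binom{j}{2}}.$$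
   Context: Let $W=\mathbb{F}_q^m$, $U=\mathbb{F}_q^{m'}$ with $m\le m'$, and $X=\operatorname{Hom}(W,U)$, identified with the $m'\times m$ matrices over $\mathbb{F}_q$. A $t$-design of index $\lambda$ in $\operatorname{Bil}_q(m,m')$ is a non-empty subset $D\subseteq X$ such that for each $t$-dimensional subspace $W_0\le W$ and each $f_0\in\operatorname{Hom}(W_0,U)$ there are exactly $\lambda$ elements $f\in D$ with $f|_{W_0}=f_0$. $\boldsymbol{1}_D\in\mathbb{C}^X$ is its characteristic vector. The group $G$ acts on $X$ by translations by matrices in $\mathbb{F}_q^{m'\times m}$ and by $f\mapsto QfP^{-1}$ for $(P,Q)\in\operatorname{GL}(m,q)\times\operatorname{GL}(m',q)$; on $\mathbb{C}^X$ it acts by $g\boldsymbol{1}_D=\boldsymbol{1}_{gD}$. Fix a non-trivial additive character $\psi:\mathbb{F}_q\to\mathbb{C}^\times$; for $C\in X$ let $\chi_C(A)=\psi(\operatorname{Tr}(C^TA))$ for $A\in X$. ${n\brack k}_q=\frac{(q^n-1)(q^{n-1}-1)\cdots(q^{n-k+1}-1)}{(q^k-1)(q^{k-1}-1)\cdots(q-1)}$ is the Gaussian binomial coefficient, with ${n\brack 0}_q=1$. *)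

(* Defs.v *)
From mathcomp Require Import all_boot all_order all_fingroup all_algebra.
From mathcomp Require Export complex reals.

Set Implicit Arguments.
Unset Strict Implicit.
Unset Printing Implicit Defensive.

Import GRing.Theory.
Local Open Scope ring_scope.

(* Throughout, W = 'cV[F]_m, U = 'cV[F]_n and Hom(W, U) = 'M[F]_(n, m), where   *)
(* f : 'M_(n, m) acts on column vectors by w |-> f *m w.                        *)

Definition restr (F : fieldType) (m n : nat) (W0 : {vspace 'cV[F]_m})
    (f : 'M[F]_(n, m)) : 'Hom(subvs_of W0, 'cV[F]_n) :=
  linfun (mulmx f \o vsval).

Definition is_design (F : finFieldType) (m n t lambda : nat)
    (D : {set 'M[F]_(n, m)}) : Prop :=
  D != set0 /\
  forall (W0 : {vspace 'cV[F]_m}) (f0 : 'Hom(subvs_of W0, 'cV[F]_n)),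
    \dim W0 = t -> #|[set f in D | restr W0 f == f0]| = lambda.

(* The elements of F^(n x m) ><| (GL_m x GL_n) are the triples (B, (P, Q)) with *)
(* P and Q invertible; (B, (P, Q)) acts on matrices by f |-> Q f P^-1 + B.      *)
Definition bil_group (F : finFieldType) (m n : nat) :
    {set 'M[F]_(n, m) * ('M[F]_m * 'M[F]_n)} :=
  [set g | (g.2.1 \in unitmx) && (g.2.2 \in unitmx)].

Definition bil_act (F : finFieldType) (m n : nat)
    (g : 'M[F]_(n, m) * ('M[F]_m * 'M[F]_n)) (f : 'M[F]_(n, m)) : 'M[F]_(n, m) :=
  g.2.2 *m f *m invmx g.2.1 + g.1.

Definition bil_mul (F : finFieldType) (m n : nat)
    (g h : 'M[F]_(n, m) * ('M[F]_m * 'M[F]_n)) :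
    'M[F]_(n, m) * ('M[F]_m * 'M[F]_n) :=
  (g.2.2 *m h.1 *m invmx g.2.1 + g.1, (g.2.1 *m h.2.1, g.2.2 *m h.2.2)).

Lemma bil_mul_group (F : finFieldType) (m n : nat) g h :
  g \in bil_group F m n -> h \in bil_group F m n -> bil_mul g h \in bil_group F m n.
Proof.
by rewrite !inE /= !unitmx_mul => /andP[-> ->] /andP[-> ->].
Qed.

Lemma bil_actM (F : finFieldType) (m n : nat) g h (f : 'M[F]_(n, m)) :
  g \in bil_group F m n -> h \in bil_group F m n ->
  bil_act (bil_mul g h) f = bil_act g (bil_act h f).
Proof.
rewrite !inE => /andP[gP _] /andP[hP _]; rewrite /bil_act /=.
have -> : invmx (g.2.1 *m h.2.1) = invmx h.2.1 *m invmx g.2.1.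
  have ghU : g.2.1 *m h.2.1 \in unitmx by rewrite unitmx_mul gP.
  apply: (can_inj (mulKmx ghU)); rewrite mulmxV //.
  by rewrite -mulmxA (mulKVmx hP) mulmxV.
by rewrite mulmxDr mulmxDl addrA !mulmxA.
Qed.

(* K^X is {ffun X -> K^o}, as K^o is what carries the K-vector space structure. *)
Definition char_vec (K : fieldType) (X : finType) (D : {set X}) :
    {ffun X -> K^o} :=
  [ffun A => (A \in D)%:R].

(* The K-span of the vectors g 1_D = 1_(gD), for g in G. *)
Definition orbit_span (K : fieldType) (F : finFieldType) (m n : nat)
    (D : {set 'M[F]_(n, m)}) : {vspace {ffun 'M[F]_(n, m) -> K^o}} :=
  <<[seq char_vec K (bil_act g @: D) | g in bil_group F m n]>>%VS.

Definition additive_character (K F : fieldType) (psi : F -> K) : Prop :=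
  (forall x, psi x != 0) /\ {morph psi : x y / x + y >-> x * y}.

Definition nontrivial (K F : fieldType) (psi : F -> K) : Prop :=
  exists x, psi x != 1.

Definition chi (K : fieldType) (F : finFieldType) (m n : nat) (psi : F -> K)
    (C : 'M[F]_(n, m)) : {ffun 'M[F]_(n, m) -> K^o} :=
  [ffun A : 'M[F]_(n, m) => psi (\tr (C^T *m A))].

Definition rank_space (K : fieldType) (F : finFieldType) (m n : nat)
    (psi : F -> K) (j : nat) : {vspace {ffun 'M[F]_(n, m) -> K^o}} :=
  <<[seq chi psi C | C in [pred C : 'M[F]_(n, m) | \rank C == j]]>>%VS.

Definition gauss_binomial (q n k : nat) : rat :=
  (\prod_(i < k) (q%:R ^+ (n - i) - 1)) / (\prod_(i < k) (q%:R ^+ (k - i) - 1)).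

(* Main.v *)
Require Import Defs.
From mathcomp Require Import all_boot all_order all_fingroup all_algebra.
From mathcomp Require Import all_field all_character.
From mathcomp Require Import complex reals.
From mathcomp Require Import ring.

Set Implicit Arguments.
Unset Strict Implicit.
Unset Printing Implicit Defensive.

Import GRing.Theory.
Local Open Scope ring_scope.

(** Write hat(C) for the Fourier coefficient fourier D C, the sum of psi (tr (C^T A))
    over A in D, and q for |F|.

    Since the span of the orbit of 1_D is stable under translations, averaging
    against characters shows that it is spanned by the characters chi_C that
    occur in some g 1_D.  The matrices P and Q move the Fourier coefficients
    along rank classes, so chi_C lies in the span exactly when hat does not
    vanish identically on the matrices of rank (rank C) [orbit_span_chi].  The
    theorem thus says for which ranks j this happens: j = 0, where hat is |D|,
    and j > t, but no j with 0 < j <= t.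

    If 0 < rank C <= t then C = Y E with E a t x m matrix of rank t, and
    tr (C^T A) depends on A only through A E^T, which by the design property
    takes every value equally often on D; a sum of a nontrivial character over
    all of F^(n x t) is zero [fourier_design_eq0].

    If j > t, suppose that hat vanishes on rank j and fix a j x m matrix E0 of
    rank j.  Parseval [parseval_mulmx] turns the sum of |hat(Y E0)|^2 over all
    n x j matrices Y into q^(nj) times a number of pairs in D, which is at least
    |D| because of the pairs (f, f).  By assumption only the Y of rank less than
    j contribute.  These factor as Y' E with E one of the at most q^(j(j-1))
    matrices of size (j - 1) x j and rank j - 1, and for each E Parseval gives
    q^(n(j-1)) times the number of pairs that agree on a space of dimension
    j - 1 >= t, which is at most lambda |D|.  Hence q^n <= q^(j(j-1)) lambda,
    which is false once n >= m^2 + lambda, because lambda < q^lambda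
    [fourier_design_neq0].

    The characters being linearly independent, the sum of the rank spaces is
    direct, and its dimension counts matrices of given rank; counting their
    transposes by recursion on the number of rows evaluates it [rank_countE].
    The dimension of the span of 0/1-vectors does not depend on the field of
    characteristic zero [dim_orbit_span_ratr], so the rational dimension is
    computed over the algebraic numbers, with any nontrivial character of F
    there. *)

(** * Designs and matrix factorizations *)

(** Restriction to a t-dimensional space is right multiplication by a matrix w
    whose columns form a basis of it; a left inverse of w extends a prescribed
    value on that space to a linear map on the whole of W. *)
Lemma design_mx_card (F : finFieldType) (m n t lambda : nat) (D : {set 'M[F]_(n, m)})
    (w : 'M[F]_(m, t)) (L : 'M[F]_(t, m)) (B : 'M[F]_(n, t)) :
  is_design t lambda D -> L *m w = 1%:M ->
  #|[set f in D | f *m w == B]| = lambda.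
Proof.
move=> [_ designD] Lw.
pose colmap : 'Hom('cV[F]_t, 'cV[F]_m) := linfun (mulmx w).
have colmapE x : colmap x = w *m x by rewrite lfunE.
have dimW : \dim (limg colmap) = t.
  rewrite limg_dim_eq ?dimvf /dim /= ?muln1 //; apply/eqP; rewrite -subv0.
  apply/subvP => x; rewrite memv_cap memv_ker colmapE => /andP[_ /eqP wx0].
  by rewrite memv0 -[x]mul1mx -Lw -mulmxA wx0 mulmx0.
rewrite -(designD (limg colmap) (restr _ (B *m L)) dimW); apply: eq_card => f.
rewrite !inE; congr (_ && _); apply/eqP/eqP => [fw | eq_restr].
  apply/lfunP => u; rewrite !lfunE /=.
  have /memv_imgP[x _ ->] := subvsP u.
  by rewrite colmapE mulmxA fw -mulmxA [L *m _]mulmxA Lw mul1mx.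
apply/matrixP => i j.
have colW : col j w \in limg colmap.
  by rewrite colE -colmapE memv_img ?memvf.
have := congr1 (fun h : 'Hom(_, 'cV[F]_n) => (h (vsproj _ (col j w)) : 'cV_n) i 0) eq_restr.
rewrite !lfunE /= vsprojK // colE !mulmxA -!colE !mxE => ->.
by have := congr1 (fun M => (B *m M) i j) Lw; rewrite /= mulmx1 mulmxA mxE.
Qed.

(** A row space of dimension at most s lies in one of dimension exactly s, so E
    may be taken of full rank even when C has smaller rank; this is what lets
    the design property be used for all these C at once. *)
Lemma mx_factor_row_free (F : fieldType) (n m s : nat) (C : 'M[F]_(n, m)) :
  (\rank C <= s <= m)%N ->
  exists2 E : 'M[F]_(s, m), row_free E & exists Y, C = Y *m E.
Proof.
case/andP=> rs sm; exists (pid_mx s *m row_ebase C).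
  by rewrite /row_free mxrankMfree ?row_free_unit ?row_ebase_unit // rank_pid_mx.
exists (col_ebase C *m pid_mx (\rank C)).
rewrite mulmxA -[in RHS](mulmxA (col_ebase C)) mul_pid_mx.
by rewrite (minn_idPl rs) (minn_idPr rs) mulmx_ebase.
Qed.

(** * Additive characters and Fourier coefficients *)

Section Fourier.

Variables (K : numClosedFieldType) (F : finFieldType) (psi : F -> K).
Hypotheses (psiP : additive_character psi) (psi_nt : nontrivial psi).

Lemma psiD x y : psi (x + y) = psi x * psi y.
Proof. by case: psiP => _ ->. Qed.

Lemma psi_neq0 x : psi x != 0.
Proof. by case: psiP. Qed.

Lemma psi0 : psi 0 = 1.
Proof. by apply: (mulfI (psi_neq0 0)); rewrite -psiD addr0 mulr1. Qed.

Lemma psiN x : psi (- x) = (psi x)^-1.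
Proof. by apply: (mulfI (psi_neq0 x)); rewrite -psiD subrr psi0 divff ?psi_neq0. Qed.

(** Values of psi are p-th roots of unity, as F has characteristic p. *)
Lemma norm_psi x : `|psi x| = 1.
Proof.
have [p p_pr pF] := finPcharP F.
have psiX k : psi (x *+ k) = psi x ^+ k.
  by elim: k => [|k IH]; rewrite ?mulr0n ?psi0 // mulrS psiD IH exprS.
apply/eqP; rewrite -(Num.Theory.pexpr_eq1 (n := p)) ?prime_gt0 ?Num.Theory.normr_ge0 //.
by rewrite -Num.Theory.normrX -psiX (mulrn_pchar pF) psi0 Num.Theory.normr1.
Qed.

Lemma conj_psi x : (psi x)^* = psi (- x).
Proof.
apply: (mulfI (psi_neq0 x)).
by rewrite -Num.Theory.normCK norm_psi expr1n psiN divff ?psi_neq0.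
Qed.

(** The trace form is nondegenerate, so for B nonzero the summand is a nontrivial
    character of Y, and translating Y multiplies the sum by a value other than 1. *)
Lemma sum_psi_tr (n k : nat) (B : 'M[F]_(n, k)) :
  \sum_(Y : 'M[F]_(n, k)) psi (\tr (Y^T *m B))
    = if B == 0 then (#|F| ^ (n * k))%:R else 0.
Proof.
case: eqP => [-> | /eqP B_neq0].
  under eq_bigr do rewrite mulmx0 mxtrace0 psi0.
  by rewrite sumr_const card_mx.
have [y psi_y] := psi_nt.
have [Y0 trY0] : exists Y0 : 'M[F]_(n, k), \tr (Y0^T *m B) = y.
  have /existsP[i /existsP[j Bij]] : [exists i, exists j, B i j != 0].
    apply: contraR B_neq0 => /existsPn B0; apply/eqP/matrixP => i j.
    by rewrite mxE; apply/eqP; have /existsPn/(_ j) := B0 i; rewrite negbK.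
  exists ((y / B i j) *: delta_mx i j).
  rewrite linearZ /= trmx_delta -scalemxAl mxtraceZ.
  rewrite (_ : \tr _ = B i j) ?divfK //.
  rewrite /mxtrace (bigD1 j) //= big1 => [|l lj]; rewrite mxE.
    rewrite addr0 (bigD1 i) //= big1 => [|r ri]; rewrite !mxE ?eqxx ?mul1r ?addr0 //.
    by rewrite (negPf ri) andbF mul0r.
  by rewrite big1 // => r _; rewrite mxE (negPf lj) mul0r.
set S := \sum_Y _; have : S = psi y * S.
  rewrite {1}/S (reindex_inj (addrI Y0)) mulr_sumr; apply: eq_bigr => Y _.
  by rewrite linearD mulmxDl mxtraceD psiD trY0.
move/eqP; rewrite -subr_eq0 -{1}[S]mul1r -mulrBl mulf_eq0 subr_eq0 eq_sym.
by rewrite (negPf psi_y) => /eqP.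
Qed.

Lemma tr_trmulC (n k : nat) (A B : 'M[F]_(n, k)) : \tr (A^T *m B) = \tr (B^T *m A).
Proof. by rewrite -mxtrace_tr trmx_mul trmxK. Qed.

Section Chi.

Variables n m : nat.
Implicit Types (A B C : 'M[F]_(n, m)) (D : {set 'M[F]_(n, m)}).

Definition fourier D C : K := \sum_(A in D) psi (\tr (C^T *m A)).

Lemma natrF_neq0 k : (#|F| ^ k)%:R != 0 :> K.
Proof.
rewrite Num.Theory.pnatr_eq0 -lt0n expn_gt0.
by rewrite (leq_trans _ (finNzRing_gt1 F)).
Qed.

Lemma fourier_inversion (h : 'M[F]_(n, m) -> K) B :
  h B = \sum_C (#|F| ^ (n * m))%:R^-1 * (\sum_A h A * psi (\tr ((- C)^T *m A)))
          * psi (\tr (C^T *m B)).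
Proof.
transitivity (\sum_C \sum_A (#|F| ^ (n * m))%:R^-1 * h A * psi (\tr (C^T *m (B - A)))).
  rewrite exchange_big /= (bigD1 B) //= [X in _ + X]big1 => [|A AB].
    rewrite addr0 -mulr_sumr sum_psi_tr subrr eqxx mulrAC mulVf ?mul1r //.
    exact: natrF_neq0.
  by rewrite -mulr_sumr sum_psi_tr subr_eq0 eq_sym (negPf AB) mulr0.
apply: eq_bigr => C _; rewrite -mulrA mulr_suml mulr_sumr.
apply: eq_bigr => A _.
rewrite mulmxBr linearN /= mulNmx mxtraceD !raddfN /= psiD.
by rewrite -!mulrA [psi (- _) * _]mulrC.
Qed.

Lemma chi_inversion (h : {ffun 'M[F]_(n, m) -> K^o}) :
  h = \sum_C ((#|F| ^ (n * m))%:R^-1 * \sum_A (h A * psi (\tr ((- C)^T *m A)) : K))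
        *: chi psi C.
Proof.
apply/ffunP => B; rewrite sum_ffunE (fourier_inversion h B).
by apply: eq_bigr => C _; rewrite !ffunE.
Qed.

(** By Fourier inversion the characters span the whole space, and there are as
    many of them as its dimension. *)
Lemma chi_free (P : pred 'M[F]_(n, m)) : free [seq chi psi C | C in P].
Proof.
suff free_all: free (map (chi psi) (enum 'M[F]_(n, m))).
  apply: (@catl_free _ _ [seq chi psi C | C in predC P]).
  rewrite /image_mem -map_cat; move: free_all.
  rewrite (@perm_free _ _ _ (map (chi psi) (enum P ++ enum (predC P)))) //.
  apply: perm_map; rewrite perm_sym.
  by rewrite [enum 'M_(n, m)]enumT; apply/permPl/perm_filterC.
apply: (@basis_free _ _ fullv); rewrite basisEdim; apply/andP; split.
  apply/subvP => h _; rewrite (chi_inversion h); apply: memv_suml => C _.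
  by apply: memvZ; apply: memv_span; apply: map_f; rewrite mem_enum.
by rewrite size_map dimvf /dim /= muln1 -cardE.
Qed.

Lemma dim_span_chi (P : pred 'M[F]_(n, m)) :
  \dim <<[seq chi psi C | C in P]>> = #|P|.
Proof. by have := chi_free P; rewrite /free => /eqP ->; rewrite size_image. Qed.

(** * The span of an orbit as a space of characters *)

Lemma bil_act_inj (g : 'M[F]_(n, m) * ('M[F]_m * 'M[F]_n)) :
  g \in bil_group F m n -> injective (bil_act g).
Proof.
rewrite inE => /andP[P_unit Q_unit] A B /addIr eqAB.
have Pi_unit : invmx g.2.1 \in unitmx by rewrite unitmx_inv.
by apply: (can_inj (mulKmx Q_unit)); apply: (can_inj (mulmxK Pi_unit)).
Qed.

Lemma fourier_act (g : 'M[F]_(n, m) * ('M[F]_m * 'M[F]_n)) D C :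
  g \in bil_group F m n ->
  fourier (bil_act g @: D) C =
    psi (\tr (C^T *m g.1)) * fourier D (g.2.2^T *m C *m (invmx g.2.1)^T).
Proof.
move=> gG; rewrite /fourier big_imset /=; last by move=> A B _ _; apply: bil_act_inj.
rewrite mulr_sumr; apply: eq_bigr => A _.
rewrite /bil_act mulmxDr mxtraceD addrC psiD; congr (_ * psi _).
by rewrite !trmx_mul !trmxK mulmxA mxtrace_mulC !mulmxA.
Qed.

(** Weighting the translates of a set by the values of chi_C projects onto the
    line of chi_C; the factor on the right is the Fourier coefficient that must
    be nonzero for chi_C to be recovered. *)
Lemma sum_translates (P : 'M[F]_m) (Q : 'M[F]_n) D C :
  P \in unitmx -> Q \in unitmx ->
  \sum_B (psi (\tr (C^T *m B)) : K) *: char_vec K (bil_act (B, (P, Q)) @: D)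
    = fourier (bil_act (0, (P, Q)) @: D) (- C) *: chi psi C.
Proof.
move=> P_unit Q_unit; set E := bil_act _ @: D.
have E0 B A : (A \in bil_act (B, (P, Q)) @: D) = (A - B \in E).
  apply/imsetP/imsetP => -[f fD defA]; exists f => //.
    by rewrite defA /bil_act /= addr0 addrK.
  by rewrite /bil_act /= -[A](subrK B) defA /bil_act /= addr0.
apply/ffunP => A; rewrite sum_ffunE !ffunE /GRing.scale /= /fourier mulr_suml.
rewrite (reindex_inj (subrI A)) /= [RHS]big_mkcond /=; apply: eq_bigr => B _.
rewrite !ffunE /GRing.scale /= E0 subKr; case: ifP => _; last by rewrite mulr0.
by rewrite mulr1 -psiD mulmxBr mxtraceD addrC !raddfN mulNmx raddfN.
Qed.

Lemma rank_equiv C C' :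
  \rank C = \rank C' -> exists2 L, L \in unitmx & exists2 R, R \in unitmx & C' = L *m C *m R.
Proof.
move=> eq_rank; exists (col_ebase C' *m invmx (col_ebase C)).
  by rewrite unitmx_mul unitmx_inv !col_ebase_unit.
exists (invmx (row_ebase C) *m row_ebase C').
  by rewrite unitmx_mul unitmx_inv !row_ebase_unit.
rewrite -[LHS]mulmx_ebase -eq_rank.
have := mulmx_ebase C; move: (col_ebase_unit C) (row_ebase_unit C).
move: (col_ebase C) (row_ebase C) (pid_mx _) => L R E L_unit R_unit <-.
by rewrite !mulmxA mulmxKV // mulmxK.
Qed.

Definition rank_in_support D C : bool :=
  [exists C', (\rank C' == \rank C) && (fourier D C' != 0)].

(** Inversion expands each g 1_D in the characters chi_C with a nonzero
    coefficient, and rank-preserving changes of variable turn this coefficient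
    into one of D.  Conversely, if hat is nonzero at some C' of the rank of C,
    some pair (P, Q) carries C' to -C, and the translates then give chi_C. *)
Lemma orbit_span_chi D :
  orbit_span K D = <<[seq chi psi C | C in rank_in_support D]>>%VS.
Proof.
apply/eqP; rewrite eqEsubv; apply/andP; split; apply/span_subvP => v /mapP[].
  move=> g; rewrite mem_enum => gG ->; rewrite (chi_inversion (char_vec _ _)).
  apply: memv_suml => C _.
  have -> : \sum_A (char_vec K (bil_act g @: D) A * psi (\tr ((- C)^T *m A)) : K)
      = fourier (bil_act g @: D) (- C).
    rewrite /fourier [RHS]big_mkcond; apply: eq_bigr => A _.
    by rewrite ffunE; case: ifP; rewrite ?mul1r ?mul0r.
  rewrite fourier_act //; set C' := g.2.2^T *m _ *m _.
  have [-> | C'_neq0] := eqVneq (fourier D C') 0.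
    by rewrite !mulr0 scale0r mem0v.
  apply: memvZ; apply: memv_span; apply: map_f; rewrite mem_enum.
  apply/existsP; exists C'; rewrite C'_neq0 andbT.
  move: gG; rewrite inE => /andP[P_unit Q_unit]; rewrite /C'.
  rewrite mxrankMfree ?row_free_unit ?unitmx_tr ?unitmx_inv // eqmxMfull ?mxrank_opp //.
  by rewrite row_full_unit unitmx_tr.
move=> C; rewrite mem_enum => /existsP[C' /andP[/eqP eq_rank C'_neq0]] ->.
have [|L L_unit [R R_unit defC']] := @rank_equiv (- C) C'.
  by rewrite mxrank_opp.
pose P := (invmx R)^T; pose Q := L^T.
have P_unit : P \in unitmx by rewrite unitmx_tr unitmx_inv.
have Q_unit : Q \in unitmx by rewrite unitmx_tr.
have G0 B : (B, (P, Q)) \in bil_group F m n by rewrite inE P_unit.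
have coef_neq0 : fourier (bil_act (0, (P, Q)) @: D) (- C) != 0.
  rewrite fourier_act // /= mulf_neq0 ?psi_neq0 //.
  by rewrite trmxK trmx_inv trmxK invmxK -defC'.
rewrite -[chi psi C](scalerK coef_neq0) -sum_translates //.
apply: memvZ; apply: memv_suml => B _; apply: memvZ; apply: memv_span.
by apply: map_f; rewrite mem_enum.
Qed.

(** The matrices Y w^T are those that pair with A only through A w; squaring and
    summing over Y by orthogonality leaves the pairs of D that agree on the
    columns of w. *)
Lemma parseval_mulmx k (w : 'M[F]_(m, k)) D :
  \sum_(Y : 'M[F]_(n, k)) `|fourier D (Y *m w^T)| ^+ 2 =
    (#|F| ^ (n * k) * \sum_(f in D) #|[set g in D | g *m w == f *m w]|)%:R.
Proof.
transitivity (\sum_(Y : 'M[F]_(n, k)) \sum_(f in D) \sum_(g in D)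
    psi (\tr (Y^T *m (f *m w - g *m w)))).
  apply: eq_bigr => Y _; rewrite Num.Theory.normCK /fourier rmorph_sum mulr_suml.
  apply: eq_bigr => f _; rewrite mulr_sumr; apply: eq_bigr => g _ /=.
  rewrite conj_psi -psiD -raddfN -raddfD -mulmxBr trmx_mul trmxK -mulmxA.
  by rewrite /= mxtrace_mulC -mulmxA mulmxBl.
rewrite exchange_big natrM natr_sum mulr_sumr; apply: eq_bigr => f _.
rewrite exchange_big -sum1_card natr_sum mulr_sumr /= [RHS]big_mkcond [LHS]big_mkcond.
apply: eq_bigr => g _; rewrite inE; case: (g \in D) => //=.
by rewrite sum_psi_tr subr_eq0 eq_sym; case: eqP; rewrite ?mulr1.
Qed.

(** Writing C = Y E with E of rank t, the phase tr (C^T A) depends only on A E^T,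
    which is equidistributed on a design, and summing a nontrivial character
    gives zero. *)
Lemma fourier_design_eq0 t lambda D C :
  is_design t lambda D -> (t <= m)%N -> (0 < \rank C <= t)%N -> fourier D C = 0.
Proof.
move=> designD le_tm /andP[C_gt0 rank_t].
have [|E /row_freeP[R ER] [Y defC]] := @mx_factor_row_free _ _ _ t C; first by rewrite rank_t.
have Y_neq0 : Y != 0.
  by apply: contraTneq C_gt0 => Y0; rewrite defC Y0 mul0mx mxrank0.
pose w := E^T; have Lw : R^T *m w = 1%:M by rewrite -trmx_mul ER trmx1.
rewrite /fourier (partition_big (fun A => A *m w) xpredT) //=.
transitivity (\sum_(B : 'M[F]_(n, t)) lambda%:R * psi (\tr (B^T *m Y))).
  apply: eq_bigr => B _; rewrite -(design_mx_card B designD Lw) -sum1_card natr_sum mulr_suml.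
  apply: eq_big => [A | A /andP[_ /eqP <-]]; first by rewrite inE.
  by rewrite mul1r defC trmx_mul -mulmxA mxtrace_mulC -mulmxA tr_trmulC.
by rewrite -mulr_sumr sum_psi_tr (negPf Y_neq0) mulr0.
Qed.

(** Two estimates of the mass of hat on the matrices with row space in a fixed
    j-dimensional space: the diagonal pairs bound it below by q^(nj) |D|, while
    without rank j it is carried by boundedly many hyperplanes, each of mass at
    most q^(n(j-1)) lambda |D|. *)
Lemma fourier_design_neq0 t lambda j D :
  is_design t lambda D -> (t < j <= m)%N -> (m * m + lambda <= n)%N ->
  exists2 C, \rank C = j & fourier D C != 0.
Proof.
move=> designD; case: j => [//|s] /andP[le_ts lt_sm] n_large.
suff /existsP[C /andP[/eqP rankC hatC]] :
    [exists C, (\rank C == s.+1) && (fourier D C != 0)] by exists C.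
apply: contraT => /existsPn hat0.
have {}hat0 C : \rank C = s.+1 -> fourier D C = 0.
  by move=> rankC; have := hat0 C; rewrite rankC eqxx negbK => /eqP.
pose E0 : 'M[F]_(s.+1, m) := pid_mx s.+1.
have E0_free : row_free E0 by rewrite /row_free rank_pid_mx.
pose T k (w : 'M[F]_(m, k)) := \sum_(f in D) #|[set g in D | g *m w == f *m w]|.
have T_large k w : (#|D| <= @T k w)%N.
  rewrite -sum1_card; apply: leq_sum => f fD.
  by rewrite card_gt0; apply/set0Pn; exists f; rewrite inE fD eqxx.
have T_small (w : 'M[F]_(m, s)) : row_free w^T -> (T s w <= #|D| * lambda)%N.
  move=> /row_freeP[L wL]; rewrite /T -sum_nat_const; apply: leq_sum => f _.
  (* Agreement on s >= t columns forces agreement on the first t of them. *)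
  have Lw : (pid_mx t *m L^T) *m (w *m pid_mx t) = 1%:M :> 'M[F]_t.
    rewrite mulmxA -(mulmxA _ L^T) -[L^T *m w]trmxK trmx_mul trmxK wL trmx1 mulmx1.
    by rewrite mul_pid_mx minnn (minn_idPr _) ?pid_mx_1.
  rewrite -(design_mx_card (f *m (w *m pid_mx t)) designD Lw); apply: subset_leq_card.
  by apply/subsetP => g; rewrite !inE !mulmxA => /andP[-> /eqP ->] /=.
have /= : (#|F| ^ (n * s.+1) * T s.+1 E0^T <=
    #|F| ^ (s * s.+1) * (#|F| ^ (n * s) * (#|D| * lambda)))%N.
  rewrite -(Num.Theory.ler_nat K) -parseval_mulmx trmxK.
  apply: (@Order.POrderTheory.le_trans _ _ (\sum_(E : 'M[F]_(s, s.+1) | row_free E)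
      \sum_(Y : 'M[F]_(n, s)) `|fourier D (Y *m E *m E0)| ^+ 2)).
    (* Every Y of rank at most s is a product Y' E, possibly for several E, and
       the terms with Y of rank s + 1 vanish. *)
    rewrite pair_big /= (partition_big (fun p => p.2 *m p.1) xpredT) //=.
    apply: Num.Theory.ler_sum => Y _.
    have [rankY|] := leqP (\rank Y) s; last first.
      move=> rankY; rewrite hat0; last first.
        by rewrite mxrankMfree //; apply/eqP; rewrite eqn_leq rankY rank_leq_col.
      rewrite Num.Theory.normr0 expr0n /=.
      by apply: Num.Theory.sumr_ge0 => p _; rewrite Num.Theory.exprn_ge0.
    have [|E E_free [Y' defY]] := @mx_factor_row_free _ _ _ s Y; first by rewrite rankY /=.
    rewrite (bigD1 (E, Y')) /=; last by rewrite E_free defY eqxx.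
    rewrite -defY Num.Theory.lerDl.
    by apply: Num.Theory.sumr_ge0 => p _; rewrite Num.Theory.exprn_ge0.
  (* q^(s(s+1)) counts all E, also those not of full rank: only an upper bound
     for the number of hyperplanes is needed. *)
  rewrite -(card_mx F s s.+1) natrM mulr_natl -sumr_const.
  rewrite [X in _ <= X](bigID (@row_free F s s.+1)) /=.
  rewrite -[X in X <= _]addr0; apply: Num.Theory.lerD; last first.
    by apply: Num.Theory.sumr_ge0 => E _; rewrite Num.Theory.ler0n.
  apply: Num.Theory.ler_sum => E E_free.
  under eq_bigr do rewrite -mulmxA -[E *m E0]trmxK.
  rewrite parseval_mulmx Num.Theory.ler_nat leq_mul2l T_small ?orbT //.
  by rewrite trmxK /row_free mxrankMfree.
have D_gt0 : (0 < #|D|)%N by case: designD => D_neq0 _; rewrite card_gt0.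
have F_gt1 : (1 < #|F|)%N := finNzRing_gt1 F.
move=> /(leq_trans (leq_mul (leqnn _) (T_large _ _))).
(* Cancel |D| and q^(ns) to be left with q^n <= q^(s(s+1)) lambda. *)
rewrite mulnCA mulnA [(_ * (#|D| * _))%N]mulnCA mulnC leq_pmul2l //.
rewrite mulnS addnC expnD -mulnA leq_pmul2l ?expn_gt0 ?(ltnW F_gt1) //.
have small : (#|F| ^ (s * s.+1) * lambda < #|F| ^ (m * m + lambda))%N.
  rewrite expnD; apply: (@leq_ltn_trans (#|F| ^ (m * m) * lambda)).
    by rewrite leq_mul2r leq_pexp2l ?orbT ?(ltnW F_gt1) // leq_mul // ltnW.
  have /ltn_pmul2l -> : (0 < #|F| ^ (m * m))%N by rewrite expn_gt0 (ltnW F_gt1).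
  exact: ltn_expl.
by move=> /leq_ltn_trans/(_ small); rewrite ltn_exp2l // ltnNge n_large.
Qed.

Definition design_spectrum t C : bool := (\rank C == 0%N) || (t < \rank C)%N.

Lemma orbit_span_design t lambda D :
  is_design t lambda D -> (t < m)%N -> (m * m + lambda <= n)%N ->
  orbit_span K D = <<[seq chi psi C | C in design_spectrum t]>>%VS.
Proof.
move=> designD lt_tm n_large; rewrite orbit_span_chi; congr (<<_>>)%VS.
apply: eq_image => // C; rewrite !unfold_in /rank_in_support /design_spectrum.
apply/existsP/idP => [[C' /andP[/eqP <- hatC']] | ].
  case: posnP => //= C'_gt0; rewrite ltnNge; apply: contra hatC' => le_t.
  by rewrite (fourier_design_eq0 designD) ?(ltnW lt_tm) // C'_gt0.
case/orP=> [/eqP-> | lt_t].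
  exists 0; rewrite mxrank0 eqxx /fourier.
  under eq_bigr do rewrite trmx0 mul0mx mxtrace0 psi0.
  rewrite sumr_const Num.Theory.pnatr_eq0 cards_eq0.
  by case: designD.
have [|C' rankC' hatC'] := @fourier_design_neq0 t lambda (\rank C) D designD _ n_large.
  by rewrite lt_t rank_leq_col.
by exists C'; rewrite rankC' eqxx.
Qed.

(** * The rank spaces *)

Lemma sum_rank_space t :
  (rank_space m n psi 0 + \sum_(j < m.+1 | (t < j)%N) rank_space m n psi j)%VS
    = <<[seq chi psi C | C in design_spectrum t]>>%VS.
Proof.
apply/eqP; rewrite eqEsubv; apply/andP; split.
  apply/subvP => v /memv_addP[v0 Uv0 [w Uw ->]]; apply: memvD.
    apply: (subvP _ _ Uv0); apply: sub_span => u /mapP[C]; rewrite mem_enum => rankC ->.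
    by apply: map_f; rewrite mem_enum unfold_in /design_spectrum (eqP rankC).
  apply: (subvP _ _ Uw); apply/subv_sumP => j lt_tj.
  apply: sub_span => u /mapP[C]; rewrite mem_enum => /eqP rankC ->.
  by apply: map_f; rewrite mem_enum unfold_in /design_spectrum rankC lt_tj orbT.
apply/span_subvP => u /mapP[C]; rewrite mem_enum => /orP[rankC | lt_t] ->.
  by apply: (subvP (addvSl _ _)); apply: memv_span; apply: map_f; rewrite mem_enum.
apply: (subvP (addvSr _ _)); have le_m : (\rank C < m.+1)%N by rewrite ltnS rank_leq_col.
apply: (subvP (sumv_sup (Ordinal le_m) lt_t (subvv _))).
by apply: memv_span; apply: map_f; rewrite mem_enum inE.
Qed.

Lemma card_design_spectrum t :
  #|[pred C : 'M[F]_(n, m) | design_spectrum t C]| =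
  (#|[pred C : 'M[F]_(n, m) | \rank C == 0%N]| +
   \sum_(j < m.+1 | (t < j)%N) #|[pred C : 'M[F]_(n, m) | \rank C == j]|)%N.
Proof.
rewrite -!sum1_card (bigID (fun C : 'M[F]_(n, m) => \rank C == 0%N)) /=; congr (_ + _)%N.
  by apply: eq_bigl => C; rewrite !inE /design_spectrum andbC; case: (_ == 0%N).
pose r (C : 'M[F]_(n, m)) : 'I_m.+1 := inord (\rank C).
have rE C : r C = \rank C :> nat by rewrite inordK // ltnS rank_leq_col.
rewrite (partition_big r (fun j : 'I_m.+1 => t < j)%N) => [|C]; last first.
  by rewrite inE rE => /andP[/orP[->|]].
apply: eq_bigr => j lt_tj; rewrite -sum1_card; apply: eq_bigl => C.
rewrite !inE -val_eqE /= rE /design_spectrum andbC; case: eqP => //= ->.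
by rewrite lt_tj orbT /= -lt0n (leq_ltn_trans _ lt_tj).
Qed.

(** The dimensions add up because both sides count matrices. *)
Lemma directv_rank_space t :
  directv (rank_space m n psi 0 + \sum_(j < m.+1 | (t < j)%N) rank_space m n psi j).
Proof.
rewrite directvE /= sum_rank_space dim_span_chi.
rewrite (eq_card (B := [pred C | design_spectrum t C])) // card_design_spectrum.
by rewrite dim_span_chi; under [in eqbRHS]eq_bigr do rewrite dim_span_chi.
Qed.

End Chi.
End Fourier.

(** * Counting matrices of given rank *)

Lemma rank_col_mx_rV (F : fieldType) (m n : nat) (v : 'rV[F]_n) (A : 'M[F]_(m, n)) :
  \rank (col_mx v A) = (\rank A + ~~ (v <= A)%MS)%N.
Proof.
rewrite -addsmxE; have [/addsmx_idPr vA | v_notin] := boolP (v <= A)%MS.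
  by rewrite vA addn0.
apply/eqP; rewrite addn1 eqn_leq; apply/andP; split.
  rewrite (leq_trans (mxrank_adds_leqif _ _)) //.
  by rewrite -[X in (_ <= X)%N]add1n leq_add2r rank_leq_row.
rewrite (ltn_leqif (mxrank_leqif_sup (addsmxSr v A))).
by apply: contra v_notin; apply: submx_trans (addsmxSl _ _).
Qed.

Section RankCount.

Variables (F : finFieldType) (n : nat).

Definition rank_count m r := #|[pred A : 'M[F]_(m, n) | \rank A == r]|.

Local Notation q := (#|F|%:R : rat).

Lemma rank_count0 m : rank_count m 0 = 1%N.
Proof.
rewrite /rank_count -(card1 (0 : 'M[F]_(m, n))); apply: eq_card => A.
by rewrite !inE mxrank_eq0.
Qed.

Lemma rank_count0S r : rank_count 0 r.+1 = 0%N.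
Proof.
apply: eq_card0 => A; rewrite !inE; apply/negbTE; apply: contraTneq isT => rankA.
by have := rank_leq_row A; rewrite rankA.
Qed.

Lemma card_submx m (A : 'M[F]_(m, n)) :
  #|[pred v : 'rV[F]_n | (v <= A)%MS]| = (#|F| ^ \rank A)%N.
Proof. by rewrite -card_rowg; apply: eq_card => v; rewrite inE mem_rowg. Qed.

(** A matrix of rank r + 1 with one more row arises from one of rank r + 1 by
    adding a row of its row space, or from one of rank r by adding a row outside
    of it. *)
Lemma rank_countS m r :
  (rank_count m.+1 r.+1)%:R =
    (rank_count m r.+1)%:R * q ^+ r.+1 + (rank_count m r)%:R * (q ^+ n - q ^+ r).
Proof.
have split_col : rank_count m.+1 r.+1 =
    (\sum_(A : 'M[F]_(m, n)) \sum_(v : 'rV[F]_n | \rank (col_mx v A) == r.+1) 1)%N.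
  rewrite pair_big_dep /= /rank_count -sum1_card.
  rewrite (reindex (fun p : 'M[F]_(m, n) * 'rV[F]_n => col_mx p.2 p.1 : 'M_(1 + m, n))).
    by apply: eq_bigl => p; rewrite inE.
  exists (fun A : 'M_(1 + m, n) => (dsubmx A, usubmx A)) => [[A v] | A] _ /=.
    by rewrite col_mxKd col_mxKu.
  exact: vsubmxK.
have col_count (A : 'M[F]_(m, n)) :
    (\sum_(v : 'rV[F]_n | \rank (col_mx v A) == r.+1) 1)%:R =
    (\rank A == r.+1)%:R * q ^+ r.+1 + (\rank A == r)%:R * (q ^+ n - q ^+ r).
  under eq_bigl do rewrite rank_col_mx_rV.
  have [rankA|rankA] := eqVneq (\rank A) r.+1.
    rewrite rankA gtn_eqF // mul1r mul0r addr0 -natrX -rankA -card_submx -sum1_card.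
    congr (_%:R); apply: eq_bigl => v; rewrite inE -[X in _ == X]addn0 eqn_add2l.
    by case: (v <= A)%MS.
  have [rankA'|rankA'] := eqVneq (\rank A) r.
    rewrite mul0r add0r mul1r -!natrX -[n in (_ ^ n)%:R - _]mul1n -(card_mx F 1 n).
    rewrite -rankA' -card_submx -(cardC [pred v | (v <= A)%MS]) natrD addrC addKr.
    rewrite -sum1_card; congr (_%:R); apply: eq_bigl => v.
    rewrite !inE -[X in _ == X]addn1 eqn_add2l.
    by case: (v <= A)%MS.
  rewrite !mul0r addr0 big_pred0 // => v.
  case: (v <= A)%MS; rewrite ?addn0 ?addn1 ?eqSS; exact: negbTE.
rewrite split_col natr_sum (eq_bigr _ (fun A _ => col_count A)) big_split /= -!mulr_suml.
have sum_rank k : \sum_(A : 'M[F]_(m, n)) (\rank A == k)%:R = (rank_count m k)%:R :> rat.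
  rewrite /rank_count -sum1_card natr_sum [RHS]big_mkcond; apply: eq_bigr => A _.
  by rewrite inE; case: eqP.
by rewrite !sum_rank.
Qed.

Lemma rank_count_tr m r : #|[pred A : 'M[F]_(n, m) | \rank A == r]| = rank_count m r.
Proof.
rewrite /rank_count -(card_imset _ (@trmx_inj F n m)); apply: eq_card => A.
apply/imsetP/idP => [[B rankB ->] | rankA]; first by rewrite inE mxrank_tr.
by exists A^T; rewrite ?trmxK // inE mxrank_tr.
Qed.

Lemma q_gt1 : 1 < q. Proof. by rewrite Num.Theory.ltr1n finNzRing_gt1. Qed.

Lemma qX1_neq0 k : (0 < k)%N -> q ^+ k - 1 != 0.
Proof.
move=> k_gt0; rewrite subr_eq0.
by rewrite Num.Theory.pexpr_eq1 ?Num.Theory.ler0n // Order.POrderTheory.gt_eqF ?q_gt1.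
Qed.

Lemma gauss_binomialSS m r :
  gauss_binomial #|F| m.+1 r.+1 * (q ^+ r.+1 - 1) =
    (q ^+ m.+1 - 1) * gauss_binomial #|F| m r.
Proof.
rewrite /gauss_binomial [X in X / _]big_ord_recl [X in _ / X]big_ord_recl /= !subn0.
under eq_bigr do rewrite /bump /= add1n subSS.
under [X in _ / (_ * X)]eq_bigr do rewrite /bump /= add1n subSS.
rewrite -!mulrA; congr (_ * (_ * _)).
by rewrite invfM mulrAC mulVf ?mul1r ?qX1_neq0.
Qed.

Lemma gauss_binomialSr m r :
  gauss_binomial #|F| m r.+1 * (q ^+ r.+1 - 1) =
    (q ^+ (m - r) - 1) * gauss_binomial #|F| m r.
Proof.
rewrite /gauss_binomial [X in X / _]big_ord_recr [X in _ / X]big_ord_recl /= subn0.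
under [X in _ / (_ * X)]eq_bigr do rewrite /bump /= add1n subSS.
rewrite -!mulrA mulrCA; congr (_ * (_ * _)).
by rewrite invfM mulrAC mulVf ?mul1r ?qX1_neq0.
Qed.

Lemma gauss_binomial_small m r : (m < r)%N -> gauss_binomial #|F| m r = 0.
Proof.
move=> lt_mr; rewrite /gauss_binomial (bigD1 (Ordinal lt_mr)) //=.
by rewrite subnn subrr !mul0r.
Qed.

(** For r > m truncated subtraction breaks q^(m-r) q^(r+1) = q^(m+1), but then
    the coefficient at r vanishes. *)
Lemma gauss_pascal m r :
  gauss_binomial #|F| m.+1 r.+1 =
    gauss_binomial #|F| m r.+1 * q ^+ r.+1 + gauss_binomial #|F| m r.
Proof.
apply: (mulIf (qX1_neq0 (ltn0Sn r))).
rewrite gauss_binomialSS [RHS]mulrDl (mulrAC (gauss_binomial _ _ r.+1)) gauss_binomialSr.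
have [le_rm | lt_mr] := leqP r m; last first.
  by rewrite (gauss_binomial_small lt_mr) !(mulr0, mul0r) addr0.
rewrite -[in q ^+ m.+1](subnK le_rm) -addnS exprD.
by ring.
Qed.

(** The closed form satisfies the recursion of [rank_countS] by the q-Pascal
    rule, as q^n - q^r = q^r (q^(n-r) - 1). *)
Lemma rank_countE m r : (r <= n)%N ->
  (rank_count m r)%:R =
    gauss_binomial #|F| m r * (\prod_(i < r) (q ^+ (n - i) - 1)) * q ^+ 'C(r, 2).
Proof.
elim: m r => [|m IHm] [|r] le_rn.
- by rewrite rank_count0 /gauss_binomial !big_ord0 divr1 !mul1r.
- by rewrite rank_count0S gauss_binomial_small ?mul0r.
- by rewrite rank_count0 /gauss_binomial !big_ord0 divr1 !mul1r.
rewrite rank_countS !IHm ?(ltnW le_rn) // gauss_pascal big_ord_recr /= binS bin1.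
rewrite -[in q ^+ n](subnK (ltnW le_rn)) exprD exprD.
by ring.
Qed.

End RankCount.

(** * Independence of the field of coefficients *)

Import VectorInternalTheory.

(** The matrix of values differs from the coordinate matrix of the tuple by an
    invertible change of coordinates.  Expressing the dimension through values
    allows comparison across fields, where abstract coordinates do not. *)
Lemma dim_span_mxrank (K : fieldType) (T : finType) (k : nat)
    (X : k.-tuple {ffun T -> K^o}) :
  \dim <<X>> = \rank (\matrix_(i < k, j < #|T|) (tnth X i (enum_val j) : K)).
Proof.
have -> : \dim <<X>> = \rank (b2mx X).
  by rewrite unlock tvalK; case: _ / (esym _); rewrite /dimv genmxE.
pose V : vectType K := {ffun T -> K^o}; pose d := dim V.
pose vec (v : 'rV[K]_d) : {ffun T -> K^o} := @r2v K V v.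
pose G : 'M[K]_(d, #|T|) := \matrix_(i, j) vec (delta_mx 0 i) (enum_val j).
have GE (v : 'rV[K]_d) j : (v *m G) 0 j = vec v (enum_val j).
  rewrite [in RHS](row_sum_delta v) /vec linear_sum sum_ffunE mxE.
  by apply: eq_bigr => i _; rewrite linearZ !ffunE mxE.
have G_free : row_free G.
  apply: inj_row_free => v vG0; apply: r2v_inj; rewrite linear0.
  apply/ffunP => x; rewrite ffunE -[x]enum_rankK -GE vG0 mxE.
  by [].
rewrite -(mxrankMfree (b2mx X) G_free); congr (\rank _).
apply/matrixP => i j; rewrite [RHS]mxE -[tnth X i]v2rK -GE.
by rewrite !mxE; apply: eq_bigr => l _; rewrite mxE.
Qed.

(** Both sides are the rank of the same 0/1-matrix. *)
Lemma dim_orbit_span_ratr (K : numFieldType) (F : finFieldType) (m n : nat)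
    (D : {set 'M[F]_(n, m)}) :
  \dim (orbit_span K D) = \dim (orbit_span rat D).
Proof.
rewrite /orbit_span /image_mem.
set s := enum _; pose h L g := char_vec L (bil_act g @: D).
rewrite -[LHS]/(\dim <<map_tuple (h K) (in_tuple s)>>).
rewrite -[RHS]/(\dim <<map_tuple (h rat) (in_tuple s)>>).
rewrite !dim_span_mxrank -(mxrank_map (@ratr K)); congr (\rank _).
apply/matrixP => i j; rewrite !mxE !tnth_map !ffunE.
exact/esym/ratr_nat.
Qed.

(** The abelian group F has |F| > 1 irreducible characters, all of them linear, so
    one of them is not principal. *)
Lemma exists_additive_character (F : finFieldType) :
  exists2 psi : F -> algC, additive_character psi & nontrivial psi.
Proof.
have abelF : abelian [set: F] := FinRing.zmod_abelian _.
have [i i_neq0] : exists i : Iirr [set: F], i != 0.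
  apply/existsP; rewrite -negb_forall; apply/negP => /forallP all0.
  have := card_Iirr_abelian abelF; rewrite cardsT (eq_card (B := pred1 0)).
    by rewrite card1 => F1; have := finNzRing_gt1 F; rewrite -F1.
  by move=> i; rewrite !inE all0.
have lin_i : 'chi_i \is a linear_char by apply: (char_abelianP _ abelF).
exists 'chi_i.
  split=> [x | x y]; first by rewrite lin_char_neq0 ?inE.
  by rewrite -FinRing.zmodMgE lin_charM ?inE.
suff /existsP[x psi_x] : [exists x, 'chi_i x != 1] by exists x.
apply: contraR i_neq0 => /existsPn chi1; apply/eqP/irr_inj/cfunP => x.
by rewrite irr0 cfun1E inE; apply/eqP; have := chi1 x; rewrite negbK.
Qed.

(** * The orbit span of a design *)

Lemma card_design_spectrumC (F : finFieldType) (n m t : nat) :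
  (#|[pred C : 'M[F]_(n, m) | design_spectrum t C]| +
    \sum_(1 <= j < t.+1) #|[pred C : 'M[F]_(n, m) | \rank C == j]|)%N
    = (#|F| ^ (m * n))%N.
Proof.
rewrite mulnC -card_mx -(cardC [pred C : 'M[F]_(n, m) | design_spectrum t C]).
congr (_ + _)%N.
under eq_bigr do rewrite -sum1_card big_mkcond.
rewrite exchange_big -sum1_card [RHS]big_mkcond; apply: eq_bigr => C _ /=.
rewrite -big_mkcond sum1_count /=.
rewrite (eq_count (a2 := pred1 (\rank C))) => [|j]; last by rewrite !inE eq_sym.
rewrite count_uniq_mem ?iota_uniq // mem_index_iota !inE /design_spectrum negb_or.
by rewrite -lt0n ltnS -leqNgt; case: (_ && _).
Qed.

Theorem theorem4p9 (m t lambda q : nat)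
    (m_ge1 : (1 <= m)%N) (t_lt_m : (t < m)%N) (lambda_ge1 : (1 <= lambda)%N)
    (q_primepower : exists p k : nat, [/\ prime p, (0 < k)%N & q = (p ^ k)%N]) :
  exists m'0 : nat,
  forall (F : finFieldType) (m' : nat) (D : {set 'M[F]_(m', m)}),
    #|F| = q -> (m'0 <= m')%N -> (m <= m')%N -> is_design t lambda D ->
    (forall (R : realType) (psi : F -> R[i]),
       additive_character psi -> nontrivial psi ->
       orbit_span R[i] D =
         (rank_space m m' psi 0
          + \sum_(j < m.+1 | (t < j)%N) rank_space m m' psi j)%VS
       /\ directv (rank_space m m' psi 0
                   + \sum_(j < m.+1 | (t < j)%N) rank_space m m' psi j))
    /\ (\dim (orbit_span rat D))%:R =
         (q%:R ^+ (m * m')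
          - \sum_(1 <= j < t.+1)
              gauss_binomial q m j * (\prod_(i < j) (q%:R ^+ (m' - i) - 1))
              * q%:R ^+ 'C(j, 2)) :> rat.
Proof.
exists (m * m + lambda)%N => F m' D cardF n_large le_m designD; subst q.
split=> [R psi psiP psi_nt | ].
  split; last exact: directv_rank_space.
  by rewrite (orbit_span_design psiP psi_nt designD t_lt_m n_large) sum_rank_space.
have [psi psiP psi_nt] := exists_additive_character F.
rewrite -(dim_orbit_span_ratr algC).
rewrite (orbit_span_design psiP psi_nt designD t_lt_m n_large) (dim_span_chi psiP psi_nt).
rewrite -natrX -(card_design_spectrumC F m' m t) natrD natr_sum.
rewrite (eq_big_nat _ _ (F2 := fun j => gauss_binomial #|F| m j *
    (\prod_(i < j) (#|F|%:R ^+ (m' - i) - 1)) * #|F|%:R ^+ 'C(j, 2))) => [|j].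
  by rewrite addrK.
rewrite ltnS => /andP[_ le_jt]; rewrite rank_count_tr rank_countE //.
by rewrite (leq_trans le_jt) ?(leq_trans (ltnW t_lt_m)).
Qed.
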